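(* Let $p\ge 1$ be an integer, $a\in\mathbb{R}$, $\Delta x,\Delta t>0$. When the flux function is $f(u)=au$, the Compact Approximate Taylor (CAT) method of parameter $p$ reduces to the high-order Lax-Wendroff method with $m=2p$: for every sequence $(u^n_i)_{i\in\mathbb{Z}}$ of real numbers, the values $u^{n+1}_i$ produced by one step of the CAT method satisfy $$u^{n+1}_i = u^n_i+\sum_{k=1}^{2p} \frac{(-1)^k c^k}{k!} \sum_{j=-p}^{p} \delta^k_{p,j}\, u^n_{i+j}\quad\text{for all } i\in\mathbb{Z},\qquad c=\frac{a\,\Delta t}{\Delta x}.$$
   Context: Coefficients. For $0\le k\le 2p$ and $-p\le j\le p$, $\delta^k_{p,j}=F_{p,j}^{(k)}(0)$, where $F_{p,j}(x)=\prod_{r=-p,\,r\ne j}^{p}\frac{x-r}{j-r}$; thus $\sum_{j=-p}^p\delta^k_{p,j}g(j)$ is the interpolatory formula for $g^{(k)}(0)$ based on the $2p+1$ nodes $-p,\dots,p$. For integers $q\in\{-p+1,\dots,p\}$, $0\le k\le 2p-1$ and $-p+1\le j\le p$, $\gamma^{k,q}_{p,j}=L_{p,j}^{(k)}(q)$, where $L_{p,j}(x)=\prod_{r=-p+1,\,r\neq j}^{p}\frac{x-r}{j-r}$; thus $\sum_{j=-p+1}^p \gamma^{k,q}_{p,j}g(j)$ is the interpolatory formula for $g^{(k)}(q)$ based on the $2p$ nodes $-p+1,\dots,p$. The coefficients $\gamma^{0,1/2}_{p,j}$, $-p+1\le j\le p$, are obtained from the $\delta^1_{p,j}$ through the relations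 $\delta^1_{p,p}=\gamma^{0,1/2}_{p,p}$, $\delta^1_{p,j}=\gamma^{0,1/2}_{p,j}-\gamma^{0,1/2}_{p,j+1}$ for $-p+1\le j\le p-1$, and $\delta^1_{p,-p}=-\gamma^{0,1/2}_{p,-p+1}$; equivalently $\gamma^{0,1/2}_{p,j}=\sum_{r=j}^p\delta^1_{p,r}$. (For $p=2$ they are $-1/12,\,7/12,\,7/12,\,-1/12$.) CAT method for $u_t+f(u)_x=0$ (uniform mesh $x_i$ of step $\Delta x$, time step $\Delta t$): $$u_i^{n+1}=u_i^n+\frac{\Delta t}{\Delta x}\left(F^p_{i-1/2}-F^p_{i+1/2}\right),\qquad F^p_{i+1/2}=\sum_{k=1}^{2p}\frac{\Delta t^{k-1}}{k!}\sum_{j=-p+1}^p\gamma^{0,1/2}_{p,j}\,\tilde f^{(k-1)}_{i,j}.$$ For each $i$, the numbers $\tilde f^{(k)}_{i,j}$ ($-p+1\le j\le p$) are computed recursively as follows. Set $\tilde f^{(0)}_{i,j}=f(u^n_{i+j})$. For $k=1,\dots,2p-1$ set, for $j,r\in\{-p+1,\dots,p\}$, $$\tilde u^{(k)}_{i,j}=-\frac1{\Delta x}\sum_{s=-p+1}^p\gamma^{1,j}_{p,s}\,\tilde f^{(k-1)}_{i,s},$$ $$\tilde f^{k,n+r}_{i,j}=f\left(u^n_{i+j}+\sum_{l=1}^k\frac{(r\Delta t)^l}{l!}\tilde u^{(l)}_{i,j}\right),$$ $$\tilde f^{(k)}_{i,j}=\frac1{\Delta t^k}\sum_{r=-p+1}^p\gamma^{k,0}_{p,r}\,\tilde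 f^{k,n+r}_{i,j}.$$ *)

(* Defs.v *)
(* The real numbers are an arbitrary [R : realFieldType], grid
   functions are maps [int -> R]. *)
From mathcomp Require Import all_boot all_order all_algebra.

Set Implicit Arguments.
Unset Strict Implicit.
Unset Printing Implicit Defensive.

Import Order.TTheory GRing.Theory Num.Theory.
Local Open Scope ring_scope.

(* The nodes -p, ..., p. *)
Definition cnodes (p : nat) : seq int :=
  [seq m%:Z - p%:Z | m <- iota 0 (2 * p).+1].

(* The nodes -p+1, ..., p. *)
Definition snodes (p : nat) : seq int :=
  [seq m%:Z - p%:Z + 1 | m <- iota 0 (2 * p)].

Definition lagrange (R : realFieldType) (s : seq int) (j : int) : {poly R} :=
  \prod_(r <- s | r != j) (((j - r)%:~R)^-1 *: ('X - (r%:~R)%:P)).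

Definition delta (R : realFieldType) (p k : nat) (j : int) : R :=
  (lagrange R (cnodes p) j)^`(k).[0].

Definition gamma (R : realFieldType) (p k : nat) (q j : int) : R :=
  (lagrange R (snodes p) j)^`(k).[q%:~R].

(* gamma^{0,1/2}_{p,j}: the solution of the telescoping relations
   delta^1_{p,j} = gamma_half j - gamma_half (j + 1), with
   delta^1_{p,p} = gamma_half p; the last one, delta^1_{p,-p} =
   - gamma_half (-p + 1), is implied since the delta^1_{p,j} sum to 0. *)
Definition gamma_half (R : realFieldType) (p : nat) (j : int) : R :=
  \sum_(r <- cnodes p | j <= r) delta R p 1 r.

Section CAT.
Variables (R : realFieldType) (p : nat) (f : R -> R) (dx dt : R).
Variables (u : int -> R) (i : int).

(* In the next three definitions [g l j] stands for the value at (l, j) of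
   the table of the tilde f^{(l)}_{i,j}. *)
Definition cat_u_of (g : nat -> int -> R) (l : nat) (j : int) : R :=
  - dx^-1 * \sum_(s <- snodes p) gamma R p 1 j s * g l.-1 s.

Definition cat_f_taylor_of (g : nat -> int -> R) (k : nat) (r j : int) : R :=
  f (u (i + j) + \sum_(1 <= l < k.+1)
                   (r%:~R * dt) ^+ l / l`!%:R * cat_u_of g l j).

Definition cat_f_of (g : nat -> int -> R) (k : nat) (j : int) : R :=
  (dt ^+ k)^-1 * \sum_(r <- snodes p) gamma R p k 0 r * cat_f_taylor_of g k r j.

(* The recursion needs all the earlier stages, hence the list
   [:: tilde f^{(0)}_{i,_}; ...; tilde f^{(k)}_{i,_}]; the equations satisfied
   by [cat_f] are [cat_f0] and [cat_fS] below. *)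
Fixpoint cat_f_list (k : nat) : seq (int -> R) :=
  if k is k'.+1 then
    let s := cat_f_list k' in rcons s (cat_f_of (nth (fun=> 0) s) k)
  else [:: fun j => f (u (i + j))].

Definition cat_f (k : nat) : int -> R := nth (fun=> 0) (cat_f_list k) k.

Definition cat_u (l : nat) (j : int) : R := cat_u_of cat_f l j.

Definition cat_f_taylor (k : nat) (r j : int) : R := cat_f_taylor_of cat_f k r j.

Lemma size_cat_f_list k : size (cat_f_list k) = k.+1.
Proof. by elim: k => //= k IH; rewrite size_rcons IH. Qed.

Lemma nth_cat_f_list k l :
  (l <= k)%N -> nth (fun=> 0) (cat_f_list k) l = cat_f l.
Proof.
elim: k => [|k IH]; first by rewrite leqn0 => /eqP ->.
rewrite leq_eqVlt => /predU1P[-> //|lk] /=.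
by rewrite nth_rcons size_cat_f_list lk; apply: IH.
Qed.

Lemma cat_f0 j : cat_f 0 j = f (u (i + j)).
Proof. by []. Qed.

Lemma cat_uE l j :
  cat_u l j = - dx^-1 * \sum_(s <- snodes p) gamma R p 1 j s * cat_f l.-1 s.
Proof. by []. Qed.

Lemma cat_f_taylorE k r j :
  cat_f_taylor k r j =
  f (u (i + j) + \sum_(1 <= l < k.+1) (r%:~R * dt) ^+ l / l`!%:R * cat_u l j).
Proof. by []. Qed.

Lemma cat_fS k j : cat_f k.+1 j =
  (dt ^+ k.+1)^-1 *
  \sum_(r <- snodes p) gamma R p k.+1 0 r * cat_f_taylor k.+1 r j.
Proof.
rewrite {1}/cat_f /= nth_rcons size_cat_f_list ltnn eqxx /cat_f_of.
congr (_ * _); apply: eq_bigr => r _; congr (_ * f (_ + _)).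
apply: eq_big_nat => -[//|l] /= lk; congr (_ * (_ * _)).
by apply: eq_bigr => s _; rewrite /= nth_cat_f_list.
Qed.

(* The numerical flux F^p_{i+1/2}. *)
Definition cat_flux : R :=
  \sum_(1 <= k < (2 * p).+1) dt ^+ k.-1 / k`!%:R *
    \sum_(j <- snodes p) gamma_half R p j * cat_f k.-1 j.

End CAT.

Definition cat_step (R : realFieldType) (p : nat) (f : R -> R) (dx dt : R)
    (u : int -> R) (i : int) : R :=
  u i + dt / dx * (cat_flux p f dx dt u (i - 1) - cat_flux p f dx dt u i).

(* Main.v *)
(** For a linear flux every stage of the CAT recursion is exact on the
    interpolation polynomial P_i of the 2p stencil values:
    f^(k)_{i,j} = a (-a/dx)^k P_i^(k)(j), because both the interpolatory
    derivative formulas on 2p nodes and the Taylor polynomials in r have degree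
    at most 2p-1.  If G is the polynomial of degree at most 2p interpolating all
    2p+1 values, then P_i - P_{i-1} = G - G(X-1), since both sides have degree
    at most 2p-1 and agree at the 2p nodes.  Summation by parts with the
    coefficients gamma^{0,1/2} turns the difference of the fluxes into the first
    derivative formula on 2p+1 nodes applied to G^(k-1), which is exact. *)
Require Import Defs.
From mathcomp Require Import all_boot all_order all_algebra.
From mathcomp Require Import ring.

Set Implicit Arguments.
Unset Strict Implicit.
Unset Printing Implicit Defensive.

Import Order.TTheory GRing.Theory Num.Theory.
Local Open Scope ring_scope.

(** * Lagrange interpolation on integer nodes *)

Section Interpolation.
Variable R : realFieldType.
Implicit Types (s : seq int) (Q : {poly R}) (v : int -> R).

Lemma size_prod_scale_XsubC (I : Type) (s : seq I) (P : pred I) (b d : I -> R) :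
  (size (\prod_(r <- s | P r) (b r *: ('X - (d r)%:P)))%R <= (count P s).+1)%N.
Proof.
elim: s => [|r s IH] /=; first by rewrite big_nil size_poly1.
rewrite big_cons; case: (P r) => //=.
apply: leq_trans (size_polyMleq _ _) _.
have := size_scale_leq (b r) ('X - (d r)%:P); rewrite size_XsubC => h.
by rewrite -subn1 leq_subLR; apply: leq_add h IH.
Qed.

(* Unqualified, [lagrange] would be the one of MathComp's qpoly. *)
Lemma size_lagrange_leq s j :
  j \in s -> (size (Defs.lagrange R s j) <= size s)%N.
Proof.
move=> js; apply: leq_trans (size_prod_scale_XsubC _ _ _ _) _.
rewrite -(count_predC (pred1 j) s) -[X in (X <= _)%N]add1n leq_add2r.
by rewrite -has_count has_pred1.
Qed.

Lemma horner_lagrange s j k :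
  k \in s -> (Defs.lagrange R s j).[k%:~R] = (k == j)%:R.
Proof.
move=> ks; rewrite horner_prod; have [->|kj] := eqVneq k j.
  rewrite big1 // => r rj; rewrite !hornerE -intrB mulVf // intr_eq0 subr_eq0.
  by rewrite eq_sym.
by rewrite (big_rem k) //= kj !hornerE subrr mulr0 mul0r.
Qed.

Definition interp s v : {poly R} := \sum_(j <- s) v j *: Defs.lagrange R s j.

Lemma size_interp s v : (size (interp s v) <= size s)%N.
Proof.
rewrite /interp big_seq; elim/big_ind: _ => [|A B hA hB|j js].
- by rewrite size_poly0.
- by rewrite (leq_trans (size_polyD _ _)) // geq_max hA.
- by rewrite (leq_trans (size_scale_leq _ _)) // size_lagrange_leq.
Qed.

Lemma horner_interp s v k :
  uniq s -> k \in s -> (interp s v).[k%:~R] = v k.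
Proof.
move=> us ks; rewrite horner_sum (bigD1_seq k) //= hornerZ horner_lagrange //.
rewrite eqxx mulr1 big1 ?addr0 // => j jk.
by rewrite hornerZ horner_lagrange // eq_sym (negbTE jk) mulr0.
Qed.

Lemma horner_derivn_interp s v k x :
  (interp s v)^`(k).[x] = \sum_(j <- s) (Defs.lagrange R s j)^`(k).[x] * v j.
Proof.
rewrite raddf_sum horner_sum /=; apply: eq_bigr => j _.
by rewrite derivnZ hornerZ mulrC.
Qed.

(** Otherwise the nonzero difference would have at least as many roots as its size; the integer
    nodes stay distinct in [R], which has characteristic 0. *)
Lemma poly_eq_on_nodes s (A B : {poly R}) : uniq s ->
  (size A <= size s)%N -> (size B <= size s)%N ->
  {in s, forall k, A.[k%:~R] = B.[k%:~R]} -> A = B.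
Proof.
move=> us sA sB AB; apply/eqP; rewrite -subr_eq0; apply: contraT => D0.
have := @max_poly_roots R (A - B) [seq k%:~R | k <- s] D0.
rewrite size_map ltnNge (leq_trans (size_polyD _ _)) ?size_polyN ?geq_max ?sA //.
apply; last by rewrite map_inj_uniq //; apply: intr_inj.
by apply/allP => _ /mapP[k ks ->]; rewrite rootE !hornerE AB // subrr.
Qed.

(** By uniqueness [Q] is its own interpolant, and the formula is the Lagrange form differentiated
    term by term. *)
Lemma derivn_formula_exact s Q k x : uniq s -> (size Q <= size s)%N ->
  \sum_(j <- s) (Defs.lagrange R s j)^`(k).[x] * Q.[j%:~R] = Q^`(k).[x].
Proof.
move=> us sQ.
have <- : interp s (fun j => Q.[j%:~R]) = Q.
  apply: (@poly_eq_on_nodes s) => //; first exact: size_interp.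
  by move=> j js; rewrite horner_interp.
rewrite horner_derivn_interp; apply: eq_big_seq => j js.
by rewrite horner_interp.
Qed.

Lemma size_derivn_leq Q k : (size Q^`(k) <= size Q)%N.
Proof.
apply/leq_sizeP => j hj; rewrite coef_derivn nth_default ?mul0rn //.
exact: leq_trans hj (leq_addl _ _).
Qed.

Lemma derivn_shift Q (b : R) k :
  (Q \Po ('X - b%:P))^`(k) = Q^`(k) \Po ('X - b%:P).
Proof.
elim: k => // k IH.
by rewrite !derivnS IH deriv_comp derivB derivX derivC subr0 mulr1.
Qed.

(** Composition with a monic polynomial of degree 1 preserves size and leading coefficient, so the
    top terms cancel. *)
Lemma size_sub_shift Q (b : R) :
  (size (Q - (Q \Po ('X - b%:P)))%R <= (size Q).-1)%N.
Proof.
set S := _ \Po _.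
have sS : size S = size Q by rewrite size_comp_poly2 ?size_XsubC.
have lS : lead_coef S = lead_coef Q.
  by rewrite lead_coef_comp ?size_XsubC // lead_coefXsubC expr1n mulr1.
apply/leq_sizeP => j; rewrite leq_eqVlt => /predU1P[<-|lt].
  by rewrite coefB -lead_coefE -sS -lead_coefE lS subrr.
by rewrite coefB !nth_default ?subrr ?sS //; case: (size Q) lt.
Qed.

End Interpolation.

(** * The two stencils and summation by parts *)

Lemma size_cnodes p : size (cnodes p) = (2 * p).+1.
Proof. by rewrite size_map size_iota. Qed.

Lemma size_snodes p : size (snodes p) = (2 * p)%N.
Proof. by rewrite size_map size_iota. Qed.

Lemma uniq_cnodes p : uniq (cnodes p).
Proof. by rewrite map_inj_uniq ?iota_uniq // => m n /addIr []. Qed.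

Lemma uniq_snodes p : uniq (snodes p).
Proof. by rewrite map_inj_uniq ?iota_uniq // => m n /addIr /addIr []. Qed.

Lemma snodes_sub_cnodes p : {subset snodes p <= cnodes p}.
Proof.
move=> _ /mapP[m + ->]; rewrite mem_iota => /= hm.
apply/mapP; exists m.+1; first by rewrite mem_iota.
by rewrite addrAC -addn1 PoszD.
Qed.

Lemma snodes_pred p j : j \in snodes p -> j - 1 \in cnodes p.
Proof.
move=> /mapP[m + ->]; rewrite mem_iota => /= hm.
apply/mapP; exists m; first by rewrite mem_iota /= ltnS ltnW.
by rewrite addrK.
Qed.

Lemma snodes_telescope (V : zmodType) (p : nat) (h : int -> V) (r : int) :
  r \in cnodes p ->
  \sum_(j <- snodes p | j <= r) (h j - h (j - 1)) = h r - h (- p%:Z).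
Proof.
move=> /mapP[m + ->]; rewrite mem_iota /= ltnS => hm.
rewrite big_map -[(2 * p)%N]subn0 -/(index_iota 0 _).
(* With [r = m - p], the node of index [n] in [snodes] is [n - p + 1], so [j <= r] means [n < m]. *)
rewrite (eq_bigl (fun n => xpredT n && (n < m)%N)) => [|n]; last first.
  by rewrite addrAC lerD2r -PoszD lez_nat addn1.
rewrite -big_nat_widen // -[X in _ = _ - h X]add0r.
have /= <- := telescope_sumr (fun n : nat => h (n%:Z - p%:Z)) (leq0n m).
apply: eq_bigr => n _.
by rewrite addrK addrAC -PoszD addn1.
Qed.

(** Abel summation: [gamma_half] is a tail sum of [delta], and exchanging the two sums leaves a
    telescoping sum for each [r]. *)
Lemma gamma_half_telescope (R : realFieldType) p (h : int -> R) :
  \sum_(j <- snodes p) gamma_half R p j * (h j - h (j - 1)) =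
  \sum_(r <- cnodes p) delta R p 1 r * (h r - h (- p%:Z)).
Proof.
under eq_bigr => j _ do rewrite mulr_suml.
rewrite (exchange_big_dep xpredT) //=; apply: eq_big_seq => r rc.
by rewrite -snodes_telescope // mulr_sumr.
Qed.

Lemma gamma_half_exact (R : realFieldType) p (G : {poly R}) k :
  (size G <= (2 * p).+1)%N ->
  \sum_(j <- snodes p)
     gamma_half R p j * (G^`(k).[j%:~R] - G^`(k).[(j - 1)%:~R]) = G^`(k.+1).[0].
Proof.
move=> sG; rewrite (gamma_half_telescope p (fun j => G^`(k).[j%:~R])).
(* The boundary term is a constant: subtracting it keeps the size within [2p + 1] and does not
   change the first derivative. *)
set b := (_.[(- p%:Z)%:~R]).
have := @derivn_formula_exact R (cnodes p) (G^`(k) - b%:P) 1 0 (uniq_cnodes p).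
rewrite size_cnodes derivn1 derivB derivC subr0 -derivnS => <-.
  by apply: eq_bigr => r _; rewrite !hornerE.
rewrite (leq_trans (size_polyD _ _)) // size_polyN geq_max.
rewrite (leq_trans (size_derivn_leq _ _)) //.
by rewrite (leq_trans (size_polyC_leq1 _)).
Qed.

(** * The CAT stages and fluxes for a linear flux *)

Section LinearFlux.
Variables (R : realFieldType) (p : nat) (a dx dt : R) (u : int -> R).
Hypothesis dt_neq0 : dt != 0.

Definition stencil_interp (i : int) : {poly R} :=
  interp (snodes p) (fun j => u (i + j)).
Local Notation P := stencil_interp.
Local Notation flux := (fun v : R => a * v).
Local Notation cf i := (cat_f p flux dx dt u i).

Lemma size_derivn_stencil_interp i k : (size (P i)^`(k) <= size (snodes p))%N.
Proof. by rewrite (leq_trans (size_derivn_leq _ _)) // size_interp. Qed.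

Lemma cat_u_linear i l j :
  {in snodes p, forall s,
     cf i l s = a * (- (a / dx)) ^+ l * (P i)^`(l).[s%:~R]} ->
  cat_u p flux dx dt u i l.+1 j =
  (- (a / dx)) ^+ l.+1 * (P i)^`(l.+1).[j%:~R].
Proof.
move=> cfl; rewrite cat_uE derivnS -derivn1.
rewrite -(@derivn_formula_exact R (snodes p)) ?uniq_snodes //; last first.
  exact: size_derivn_stencil_interp.
rewrite !mulr_sumr; apply: eq_big_seq => s ss.
by rewrite /= cfl // /gamma exprS; ring.
Qed.

(* The Taylor polynomial of [P i] at [j], as a polynomial in the time-step index [r] of the scheme. *)
Definition time_taylor i k (j : int) : {poly R} :=
  \sum_(0 <= l < k.+1)
     (((- (a / dx) * dt) ^+ l / l`!%:R * (P i)^`(l).[j%:~R]) *: 'X^l).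

Lemma cat_f_linear i k j : (k < 2 * p)%N -> j \in snodes p ->
  cf i k j = a * (- (a / dx)) ^+ k * (P i)^`(k).[j%:~R].
Proof.
(* Strong induction, since the Taylor sum of stage [k.+1] involves all earlier stages. *)
elim/ltn_ind: k j => -[|k] IH j hk js.
  by rewrite cat_f0 expr0 mulr1 derivn0 horner_interp ?uniq_snodes.
have T r : cat_f_taylor p flux dx dt u i k.+1 r j =
           a * (time_taylor i k.+1 j).[r%:~R].
  rewrite cat_f_taylorE; congr (_ * _).
  (* The term [l = 0] is the value of [P i] at the node [j], that is [u (i + j)]. *)
  rewrite /time_taylor horner_sum [RHS]big_nat_recl // expr0 fact0 invr1 !mul1r.
  rewrite derivn0 horner_interp ?uniq_snodes // hornerZ hornerXn expr0 mulr1.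
  congr (_ + _); rewrite big_add1 /=; apply: eq_big_nat => l /= hl.
  rewrite cat_u_linear => [|s ss].
    by rewrite hornerZ hornerXn !exprMn; ring.
  by apply: IH => //; apply: leq_trans hk; rewrite ltnS ltnW.
(* The bound [k.+1 < 2 * p] makes degree [k + 1] in the time index fit the [2p] nodes. *)
have sT : (size (time_taylor i k.+1 j) <= size (snodes p))%N.
  rewrite size_snodes; apply: leq_trans hk; rewrite /time_taylor big_seq.
  elim/big_ind: _ => [|A B hA hB|l].
  - by rewrite size_poly0.
  - by rewrite (leq_trans (size_polyD _ _)) // geq_max hA.
  - rewrite mem_index_iota => /= hl.
    by rewrite (leq_trans (size_scale_leq _ _)) // size_polyXn.
(* At 0 only the top monomial survives, and its derivative cancels the factorial. *)
have dT : (time_taylor i k.+1 j)^`(k.+1).[0] =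
          (- (a / dx) * dt) ^+ k.+1 * (P i)^`(k.+1).[j%:~R].
  rewrite horner_coef0 coef_derivn addn0 ffactnn /time_taylor coef_sum.
  rewrite big_nat_recr //= big_nat big1 => [|l /= hl].
    rewrite add0r coefZ coefXn eqxx mulr1 -mulr_natr.
    by field; rewrite pnatr_eq0 -lt0n fact_gt0.
  by rewrite coefZ coefXn gtn_eqF ?mulr0.
rewrite cat_fS; under eq_bigr => r _ do rewrite T mulrCA.
rewrite -mulr_sumr (@derivn_formula_exact R (snodes p)) ?uniq_snodes // dT.
by rewrite exprMn; field; rewrite expf_neq0.
Qed.

(** For [s] in [snodes], both [s] and [s - 1] lie in [cnodes], so [G] takes there the values
    [u (i + s)] and [u (i - 1 + s)]. *)
Lemma interp_sub_prev i :
  let G := interp (cnodes p) (fun j => u (i + j)) in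
  P i - P (i - 1) = G - (G \Po ('X - 1%:P)).
Proof.
move=> G; apply: (@poly_eq_on_nodes R (snodes p)); rewrite ?uniq_snodes //.
- by rewrite (leq_trans (size_polyD _ _)) // size_polyN geq_max !size_interp.
- rewrite size_snodes (leq_trans (size_sub_shift _ _)) //.
  have := size_interp (cnodes p) (fun j => u (i + j)).
  by rewrite size_cnodes -/G; case: (size G).
move=> s ss; rewrite !hornerE horner_comp !hornerE.
have -> : s%:~R - 1 = (s - 1)%:~R :> R by rewrite intrB.
rewrite !horner_interp ?uniq_snodes ?uniq_cnodes ?snodes_pred //; last first.
  exact: snodes_sub_cnodes.
by rewrite addrAC addrA.
Qed.

Lemma cat_flux_linear i :
  cat_flux p flux dx dt u i =
  \sum_(0 <= k < 2 * p) dt ^+ k / k.+1`!%:R * (a * (- (a / dx)) ^+ k) *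
    \sum_(j <- snodes p) gamma_half R p j * (P i)^`(k).[j%:~R].
Proof.
rewrite /cat_flux big_add1 /=; apply: eq_big_nat => k /= hk.
rewrite -[RHS]mulrA; congr (_ * _); rewrite mulr_sumr; apply: eq_big_seq => j js.
by rewrite cat_f_linear // mulrCA.
Qed.

(** Both sides equal [G^(k+1)(0)]: the left by [gamma_half_exact], the right by differentiating the
    Lagrange form of [G]. *)
Lemma gamma_half_interp_sub i k :
  \sum_(j <- snodes p) gamma_half R p j * (P i)^`(k).[j%:~R] -
  \sum_(j <- snodes p) gamma_half R p j * (P (i - 1))^`(k).[j%:~R] =
  \sum_(j <- cnodes p) delta R p k.+1 j * u (i + j).
Proof.
rewrite -sumrB; set G := interp (cnodes p) (fun j => u (i + j)).
have sG : (size G <= (2 * p).+1)%N by rewrite -size_cnodes size_interp.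
transitivity G^`(k.+1).[0].
  rewrite -(gamma_half_exact _ sG); apply: eq_bigr => j _.
  rewrite -mulrBr; congr (_ * _).
  rewrite -hornerN -hornerD -derivnB interp_sub_prev -/G derivnB derivn_shift.
  by rewrite !hornerE horner_comp !hornerE intrB.
exact: horner_derivn_interp.
Qed.

End LinearFlux.

Theorem theorem1 (R : realFieldType) (p : nat) (hp : (1 <= p)%N)
  (a dx dt : R) (hdx : 0 < dx) (hdt : 0 < dt) (u : int -> R) (i : int) :
  let c := a * dt / dx in
  cat_step p (fun v : R => a * v) dx dt u i =
  u i + \sum_(1 <= k < (2 * p).+1) ((-1) ^+ k * c ^+ k / k`!%:R *
          \sum_(j <- cnodes p) delta R p k j * u (i + j)).
Proof.
move=> c; have dt0 : dt != 0 by rewrite gt_eqF.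
rewrite /cat_step !cat_flux_linear //; congr (_ + _).
rewrite -sumrB mulr_sumr big_add1 /=; apply: eq_big_nat => k _.
rewrite -gamma_half_interp_sub.
(* Powers of [c] come from [dt * (- (a / dx)) = - c]; the outer minus sign appears because the step
   takes the left flux minus the right one. *)
have -> : (-1) ^+ k.+1 * c ^+ k.+1 =
          - (dt / dx * (dt ^+ k * (a * (- (a / dx)) ^+ k))).
  rewrite -exprMn (_ : -1 * c = dt * (- (a / dx))) /c; last by ring.
  by rewrite exprS exprMn; ring.
by ring.
Qed.
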